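(* Let $\mathcal E$ be an (axiomatic) extension of the logic $\mathcal{DHMSH}$. The Deduction Property holds in $\mathcal E$ for the connective $\to_H$ if and only if the corresponding variety $\mathbb E$ is of the form $\mathbb V^e$, where $\mathbb V$ is a subvariety of the variety $\mathbb{S}\mathrm{t}\mathbb{SH}$ of Stone semi-Heyting algebras.
   Context: Language: $\langle\vee,\wedge,\to,\sim,\bot,\top\rangle$ of arities $2,2,2,1,0,0$; formulas are built over a countably infinite set of propositional variables. The abbreviation $\alpha\to_H\beta$ stands for $\alpha\to(\alpha\wedge\beta)$. The logic $\mathcal{DHMSH}$ is the Hilbert-style logic with axiom schemes: (A1) $\alpha\to_H(\alpha\vee\beta)$; (A2) $\beta\to_H(\alpha\vee\beta)$; (A3) $(\alpha\to_H\gamma)\to_H[(\beta\to_H\gamma)\to_H((\alpha\vee\beta)\to_H\gamma)]$; (A4) $(\alpha\wedge\beta)\to_H\alpha$; (A5) $(\gamma\to_H\alpha)\to_H[(\gamma\to_H\beta)\to_H(\gamma\to_H(\alpha\wedge\beta))]$; (A6) $\top$; (A7) $\bot\to_H\alpha$; (A8) $((\alpha\wedge\beta)\to_H\gamma)\to_H(\alpha\to_H(\beta\to_H\gamma))$; (A9) $(\alpha\to_H(\beta\to_H\gamma))\to_H((\alpha\wedge\beta)\to_H\gamma)$; (A10) $(\alpha\to_H\beta)\to_H((\beta\to_H\alpha)\to_H((\alpha\to\gamma)\to_H(\beta\to\gamma)))$; (A11) $(\alpha\to_H\beta)\to_H((\beta\to_H\alpha)\to_H((\gamma\to\beta)\to_H(\gamma\to\alpha)))$;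 (A12) $\top\to_H{\sim}\bot$; (A13) ${\sim}\top\to_H\bot$; (A14) ${\sim}(\alpha\wedge\beta)\to_H({\sim}\alpha\vee{\sim}\beta)$; and rules (SMP): from $\phi$ and $\phi\to_H\gamma$ deduce $\gamma$; (SCP): from $\phi\to_H\gamma$ deduce ${\sim}\gamma\to_H{\sim}\phi$. $\Gamma\vdash\phi$ means that $\phi$ is derivable from axioms and members of $\Gamma$ by these rules (both rules may be applied to any formulas already derived from $\Gamma$). An axiomatic extension is obtained by adjoining new axiom schemes and keeping the same rules. A logic $\mathcal L$ has the Deduction Property for a binary connective $\Rightarrow$ if for all sets of formulas $\Gamma\cup\{\alpha,\beta\}$: $\Gamma,\alpha\vdash_{\mathcal L}\beta$ if and only if $\Gamma\vdash_{\mathcal L}\alpha\Rightarrow\beta$. A semi-Heyting algebra is an algebra $\langle L,\vee,\wedge,\to,0,1\rangle$ such that $\langle L,\vee,\wedge,0,1\rangle$ is a lattice with $0$ and $1$, and $x\wedge(x\to y)\approx x\wedge y$, $x\wedge(y\to z)\approx x\wedge[(x\wedge y)\to(x\wedge z)]$, $x\to x\approx1$. Put $x^*:=x\to0$. A Stone semi-Heyting algebra is a semi-Heyting algebra satisfying $x^*\vee x^{**}\approx1$. $\mathbb{DHMSH}$ is the variety of algebras $\langle A,\vee,\wedge,\to,{}',0,1\rangle$ such that $\langle A,\vee,\wedge,\to,0,1\rangle$ is a semi-Heyting algebra and $0'\approx1$, $1'\approx0$, $(x\wedge y)'\approx x'\vee y'$. Formulas are interpreted with $\sim,\bot,\top$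 as ${}',0,1$. The variety corresponding to an extension $\mathcal E$ is $\mathbb E=\{\mathbf A\in\mathbb{DHMSH}:\mathbf A\models\delta\approx1\text{ for every theorem }\delta\text{ of }\mathcal E\}$. For a Stone semi-Heyting algebra $\mathbf L$, $\mathbf L^e$ is its expansion by the unary operation $x':=x^*$; for a subvariety $\mathbb V$ of $\mathbb{S}\mathrm{t}\mathbb{SH}$, $\mathbb V^e:=\{\mathbf L^e:\mathbf L\in\mathbb V\}$ (a subvariety of $\mathbb{DHMSH}$). *)

(* Defs.v *)
From Stdlib Require Import Ensembles FinFun.

Set Implicit Arguments.
Unset Strict Implicit.
Unset Printing Implicit Defensive.

Reserved Notation "x ∨ y" (at level 50, left associativity).
Reserved Notation "x ∧ y" (at level 40, left associativity).
Reserved Notation "x → y" (at level 55, right associativity).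
Reserved Notation "x ⇒ y" (at level 55, right associativity).
Reserved Notation "∼ x" (at level 35, right associativity).
Reserved Notation "⊥".
Reserved Notation "⊤".

(** * Formulas *)

Inductive formula : Set :=
| Var : nat -> formula
| Or : formula -> formula -> formula
| And : formula -> formula -> formula
| Imp : formula -> formula -> formula
| Neg : formula -> formula
| Bot : formula
| Top : formula.

Declare Scope fml_scope.
Delimit Scope fml_scope with fml.
Bind Scope fml_scope with formula.
Notation "a ∨ b" := (Or a b) : fml_scope.
Notation "a ∧ b" := (And a b) : fml_scope.
Notation "a → b" := (Imp a b) : fml_scope.
Notation "∼ a" := (Neg a) : fml_scope.
Notation "⊥" := Bot : fml_scope.
Notation "⊤" := Top : fml_scope.

Definition ImpH (a b : formula) : formula := (a → (a ∧ b))%fml.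
Notation "a ⇒ b" := (ImpH a b) : fml_scope.

Fixpoint subst (s : nat -> formula) (a : formula) : formula :=
  match a with
  | Var n => s n
  | Or a b => Or (subst s a) (subst s b)
  | And a b => And (subst s a) (subst s b)
  | Imp a b => Imp (subst s a) (subst s b)
  | Neg a => Neg (subst s a)
  | Bot => Bot
  | Top => Top
  end.

(** * The logic DHMSH and its axiomatic extensions *)

Inductive DHMSH_axiom : formula -> Prop :=
| A1 a b : DHMSH_axiom (a ⇒ (a ∨ b))
| A2 a b : DHMSH_axiom (b ⇒ (a ∨ b))
| A3 a b c : DHMSH_axiom ((a ⇒ c) ⇒ ((b ⇒ c) ⇒ ((a ∨ b) ⇒ c)))
| A4 a b : DHMSH_axiom ((a ∧ b) ⇒ a)
| A5 a b c : DHMSH_axiom ((c ⇒ a) ⇒ ((c ⇒ b) ⇒ (c ⇒ (a ∧ b))))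
| A6 : DHMSH_axiom ⊤
| A7 a : DHMSH_axiom (⊥ ⇒ a)
| A8 a b c : DHMSH_axiom (((a ∧ b) ⇒ c) ⇒ (a ⇒ (b ⇒ c)))
| A9 a b c : DHMSH_axiom ((a ⇒ (b ⇒ c)) ⇒ ((a ∧ b) ⇒ c))
| A10 a b c : DHMSH_axiom ((a ⇒ b) ⇒ ((b ⇒ a) ⇒ ((a → c) ⇒ (b → c))))
| A11 a b c : DHMSH_axiom ((a ⇒ b) ⇒ ((b ⇒ a) ⇒ ((c → b) ⇒ (c → a))))
| A12 : DHMSH_axiom (⊤ ⇒ ∼ ⊥)
| A13 : DHMSH_axiom (∼ ⊤ ⇒ ⊥)
| A14 a b : DHMSH_axiom (∼ (a ∧ b) ⇒ (∼ a ∨ ∼ b)).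

(** An extension is given by the set [S] of its new axiom schemes, a scheme
    being represented by one formula standing for all its substitution
    instances. [S = Empty_set _] gives DHMSH itself. *)
Inductive derives (S Γ : Ensemble formula) : formula -> Prop :=
| d_axiom a : DHMSH_axiom a -> derives S Γ a
| d_scheme s a : In _ S a -> derives S Γ (subst s a)
| d_hyp a : In _ Γ a -> derives S Γ a
| d_SMP a b : derives S Γ a -> derives S Γ (a ⇒ b) -> derives S Γ b
| d_SCP a b : derives S Γ (a ⇒ b) -> derives S Γ (∼ b ⇒ ∼ a).

Definition is_theorem (S : Ensemble formula) (a : formula) : Prop :=
  derives S (Empty_set formula) a.

Definition deduction_property (L : Ensemble formula -> formula -> Prop)
    (conn : formula -> formula -> formula) : Prop :=
  forall (Γ : Ensemble formula) (a b : formula),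
    L (Add formula Γ a) b <-> L Γ (conn a b).

(** * Algebras

    The records carry the operations only; the identities are separate
    predicates. *)

Record sh_algebra : Type := SHAlgebra {
  sh_car :> Type;
  join : sh_car -> sh_car -> sh_car;
  meet : sh_car -> sh_car -> sh_car;
  imp : sh_car -> sh_car -> sh_car;
  zero : sh_car;
  one : sh_car
}.
Arguments zero {s}.
Arguments one {s}.

Record dh_algebra : Type := DHAlgebra {
  dh_reduct :> sh_algebra;
  neg : dh_reduct -> dh_reduct
}.

Declare Scope alg_scope.
Delimit Scope alg_scope with alg.
Notation "x ∨ y" := (join x y) : alg_scope.
Notation "x ∧ y" := (meet x y) : alg_scope.
Notation "x → y" := (imp x y) : alg_scope.
Notation "∼ x" := (neg x) : alg_scope.
Notation "⊥" := zero : alg_scope.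
Notation "⊤" := one : alg_scope.

Definition star (L : sh_algebra) (x : L) : L := (x → ⊥)%alg.

Record bounded_lattice (L : sh_algebra) : Prop := {
  joinC : forall x y : L, (x ∨ y = y ∨ x)%alg;
  meetC : forall x y : L, (x ∧ y = y ∧ x)%alg;
  joinA : forall x y z : L, (x ∨ (y ∨ z) = (x ∨ y) ∨ z)%alg;
  meetA : forall x y z : L, (x ∧ (y ∧ z) = (x ∧ y) ∧ z)%alg;
  joinK : forall x y : L, (x ∨ (x ∧ y) = x)%alg;
  meetK : forall x y : L, (x ∧ (x ∨ y) = x)%alg;
  meet_zero : forall x : L, (x ∧ ⊥ = ⊥)%alg;
  join_one : forall x : L, (x ∨ ⊤ = ⊤)%alg
}.

Record semi_heyting (L : sh_algebra) : Prop := {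
  sh_lattice : bounded_lattice L;
  sh_meet_imp : forall x y : L, (x ∧ (x → y) = x ∧ y)%alg;
  sh_meet_imp2 : forall x y z : L,
    (x ∧ (y → z) = x ∧ ((x ∧ y) → (x ∧ z)))%alg;
  sh_imp_refl : forall x : L, (x → x = ⊤)%alg
}.

Record stone_semi_heyting (L : sh_algebra) : Prop := {
  st_semi_heyting : semi_heyting L;
  st_stone : forall x : L, (star x ∨ star (star x) = ⊤)%alg
}.

Record DHMSH_algebra (A : dh_algebra) : Prop := {
  dh_semi_heyting : semi_heyting A;
  neg_zero : (∼ (⊥ : A) = ⊤)%alg;
  neg_one : (∼ (⊤ : A) = ⊥)%alg;
  neg_meet : forall x y : A, (∼ (x ∧ y) = ∼ x ∨ ∼ y)%alg
}.

Fixpoint eval (A : dh_algebra) (v : nat -> A) (a : formula) : A :=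
  match a with
  | Var n => v n
  | Or a b => join (eval v a) (eval v b)
  | And a b => meet (eval v a) (eval v b)
  | Imp a b => imp (eval v a) (eval v b)
  | Neg a => neg (eval v a)
  | Bot => zero
  | Top => one
  end.

Definition satisfies (A : dh_algebra) (a b : formula) : Prop :=
  forall v : nat -> A, eval v a = eval v b.

Definition corresponding_variety (S : Ensemble formula) (A : dh_algebra) : Prop :=
  DHMSH_algebra A /\ forall d, is_theorem S d -> satisfies A d ⊤.

(** * Varieties of algebras of type (∨, ∧, →, 0, 1) *)

Record sh_hom (L M : sh_algebra) (f : L -> M) : Prop := {
  hom_join : forall x y : L, (f (x ∨ y) = f x ∨ f y)%alg;
  hom_meet : forall x y : L, (f (x ∧ y) = f x ∧ f y)%alg;
  hom_imp : forall x y : L, (f (x → y) = f x → f y)%alg;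
  hom_zero : f zero = zero;
  hom_one : f one = one
}.

Definition sh_prod (I : Type) (L : I -> sh_algebra) : sh_algebra :=
  @SHAlgebra (forall i, L i)
    (fun x y i => join (x i) (y i))
    (fun x y i => meet (x i) (y i))
    (fun x y i => imp (x i) (y i))
    (fun i => zero)
    (fun i => one).

(** Subalgebras are given by embeddings, hence up to isomorphism; products
    include the empty one, so a variety contains a trivial algebra. *)
Record variety (K : sh_algebra -> Prop) : Prop := {
  variety_H : forall (L M : sh_algebra) (f : L -> M),
    sh_hom f -> Surjective f -> K L -> K M;
  variety_S : forall (L M : sh_algebra) (f : L -> M),
    sh_hom f -> Injective f -> K M -> K L;
  variety_P : forall (I : Type) (L : I -> sh_algebra),
    (forall i, K (L i)) -> K (sh_prod L)
}.

Definition subvariety (V K : sh_algebra -> Prop) : Prop :=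
  variety V /\ forall L, V L -> K L.

Definition expansion (L : sh_algebra) : dh_algebra :=
  @DHAlgebra L (@star L).

Definition expansion_class (V : sh_algebra -> Prop) (A : dh_algebra) : Prop :=
  exists L : sh_algebra, V L /\ A = expansion L.

(* Main.v *)
Require Import Defs.
From Stdlib Require Import Ensembles.
From Stdlib Require Import FunctionalExtensionality PropExtensionality.
From Stdlib Require Import ProofIrrelevance IndefiniteDescription.

Set Implicit Arguments.
Unset Strict Implicit.
Unset Printing Implicit Defensive.

(** The Deduction Property for [⇒] amounts to [∼] being the pseudocomplement.

    From left to right, [{a ⇒ b} ⊢ ∼b ⇒ ∼a] by the contraposition rule, so the
    Deduction Property makes [(a ⇒ b) ⇒ (∼b ⇒ ∼a)] a theorem. Since [⇒] is the
    Heyting implication of a semi-Heyting algebra, the identity it expresses,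
    at [b = 0] and at [a = 1], forces [x' = x*] in every algebra of the
    variety ([neg_star_of_contraposition]). The Stone identity is then
    [(x ∧ x')' = x' ∨ x''] together with [x ∧ x' = 0] ([stone_of_neg_star]).
    The semi-Heyting algebras [L] whose expansion [L^e] is in the variety of the
    logic form an equational class ([variety_of_identities]), and this is the
    required [V].

    From right to left, the Lindenbaum algebra of any theory belongs to the
    variety of the logic ([lindenbaum_corresponding_variety]); as that variety
    consists of expansions, [∼a] and [a → ⊥] are interderivable. Then
    [c ⇒ (a ⇒ b)] yields [c ⇒ (∼b ⇒ ∼a)], the only step that is not routine
    in the induction proving the deduction theorem
    ([deduction_property_of_neg]). That the Lindenbaum algebra satisfies the
    identities of the variety rests on a development of the calculus in which
    reflexivity and transitivity of [⇒] have to be derived. *)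

(** * The provability preorder of a theory *)

Section Provability.

Context (S Γ : Ensemble formula).

Local Notation "⊢ a" := (derives S Γ a%fml) (at level 75, no associativity).
Local Notation "a ≼ b" := (derives S Γ (ImpH a%fml b%fml))
  (at level 70, no associativity).

(** Equivalence of formulas in the theory [Γ]. It is stated with [⇒], as
    derivability of [b] from [a] is in general weaker. *)
Definition interderivable (a b : formula) : Prop := a ≼ b /\ b ≼ a.

Local Notation "a ≈ b" := (interderivable a%fml b%fml)
  (at level 70, no associativity).

Lemma derives_weaken a b : ⊢ b -> a ≼ b.
Proof.
intros Hb.
exact (d_SMP Hb (d_SMP (d_axiom _ _ (A4 b a)) (d_axiom _ _ (A8 b a b)))).
Qed.

Lemma le_and_l a b : a ∧ b ≼ a.
Proof. exact (d_axiom _ _ (A4 a b)). Qed.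

Lemma le_and a b c : c ≼ a -> c ≼ b -> c ≼ a ∧ b.
Proof.
intros Ha Hb.
exact (d_SMP Hb (d_SMP Ha (d_axiom _ _ (A5 a b c)))).
Qed.

Lemma le_curry a b c : a ∧ b ≼ c -> a ≼ b ⇒ c.
Proof. intros H; exact (d_SMP H (d_axiom _ _ (A8 a b c))). Qed.

Lemma le_uncurry a b c : a ≼ b ⇒ c -> a ∧ b ≼ c.
Proof. intros H; exact (d_SMP H (d_axiom _ _ (A9 a b c))). Qed.

Lemma derives_imp_congr_l a b c : a ≈ b -> ⊢ a → c -> ⊢ b → c.
Proof.
intros [Hab Hba] H.
exact (d_SMP H (d_SMP Hba (d_SMP Hab (d_axiom _ _ (A10 a b c))))).
Qed.

Lemma derives_imp_congr_r a b c : a ≈ b -> ⊢ c → a -> ⊢ c → b.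
Proof.
intros [Hab Hba] H.
exact (d_SMP H (d_SMP Hab (d_SMP Hba (d_axiom _ _ (A11 b a c))))).
Qed.

Lemma interderivable_sym a b : a ≈ b -> b ≈ a.
Proof. intros [H K]; exact (conj K H). Qed.

(** Reflexivity is not an axiom. The theorem [a ⇒ ⊤] is [a → (a ∧ ⊤)], while
    [a ⇒ a] is [a → (a ∧ a)], and [a ∧ ⊤] and [a ∧ a] are interderivable using
    only the first projection and weakening. *)
Lemma le_refl a : a ≼ a.
Proof.
pose proof (d_axiom S Γ A6) as top.
apply (@derives_imp_congr_r (a ∧ ⊤)%fml).
- split; apply le_and; auto using le_and_l, derives_weaken.
- exact (derives_weaken a top).
Qed.

Lemma interderivable_refl a : a ≈ a.
Proof. split; apply le_refl. Qed.

Lemma le_and_r a b : a ∧ b ≼ b.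
Proof. apply le_uncurry, derives_weaken, le_refl. Qed.

Lemma and_comm a b : a ∧ b ≈ b ∧ a.
Proof. split; apply le_and; auto using le_and_l, le_and_r. Qed.

Lemma le_and_weaken_r a b c : b ≼ c -> a ∧ b ≼ c.
Proof. intros H; apply le_uncurry, derives_weaken, H. Qed.

Lemma and_congr_r a b c : b ≈ c -> a ∧ b ≈ a ∧ c.
Proof.
intros [H K]; split; apply le_and; auto using le_and_l, le_and_weaken_r.
Qed.

Lemma le_congr_r a b c : b ≈ c -> a ≼ b -> a ≼ c.
Proof. intros H; apply derives_imp_congr_r, and_congr_r, H. Qed.

Lemma interderivable_trans a b c : a ≈ b -> b ≈ c -> a ≈ c.
Proof.
intros [Hab Hba] [Hbc Hcb]; split.
- exact (le_congr_r (conj Hbc Hcb) Hab).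
- exact (le_congr_r (conj Hba Hab) Hcb).
Qed.

Lemma and_congr_l a b c : a ≈ b -> a ∧ c ≈ b ∧ c.
Proof.
intros H; apply (interderivable_trans (and_comm a c)).
exact (interderivable_trans (and_congr_r c H) (and_comm c b)).
Qed.

Lemma le_congr_l a b c : a ≈ b -> a ≼ c -> b ≼ c.
Proof.
intros H K; apply (derives_imp_congr_r (and_congr_l c H)).
exact (derives_imp_congr_l H K).
Qed.

(** The reason for transitivity: [a ≼ b] makes [a] interderivable with [a ∧ b],
    and [b ≼ c] gives [a ∧ b ≼ c] by weakening. *)
Lemma le_trans a b c : a ≼ b -> b ≼ c -> a ≼ c.
Proof.
intros Hab Hbc; apply (@le_congr_l (a ∧ b)%fml).
- split; [apply le_and_l | apply le_and; [apply le_refl | exact Hab]].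
- apply le_and_weaken_r, Hbc.
Qed.

Lemma le_mp a b c : a ≼ b -> a ≼ b ⇒ c -> a ≼ c.
Proof.
intros H K; apply (@le_trans _ ((b ⇒ c) ∧ b)%fml).
- apply le_and; assumption.
- apply le_uncurry, le_refl.
Qed.

Lemma le_or_l a b : a ≼ a ∨ b.
Proof. exact (d_axiom _ _ (A1 a b)). Qed.

Lemma le_or_r a b : b ≼ a ∨ b.
Proof. exact (d_axiom _ _ (A2 a b)). Qed.

Lemma or_le a b c : a ≼ c -> b ≼ c -> a ∨ b ≼ c.
Proof.
intros Ha Hb.
exact (d_SMP Hb (d_SMP Ha (d_axiom _ _ (A3 a b c)))).
Qed.

Lemma bot_le a : ⊥ ≼ a.
Proof. exact (d_axiom _ _ (A7 a)). Qed.

Lemma le_top a : a ≼ ⊤.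
Proof. exact (derives_weaken a (d_axiom _ _ A6)). Qed.

Lemma neg_le a b : a ≼ b -> ∼ b ≼ ∼ a.
Proof. apply d_SCP. Qed.

Lemma le_imp_congr_l x a b c :
  x ≼ a ⇒ b -> x ≼ b ⇒ a -> x ≼ (a → c) ⇒ (b → c).
Proof.
intros Hab Hba; apply (le_mp Hba), (le_mp Hab), derives_weaken.
exact (d_axiom _ _ (A10 a b c)).
Qed.

Lemma le_imp_congr_r x a b c :
  x ≼ a ⇒ b -> x ≼ b ⇒ a -> x ≼ (c → a) ⇒ (c → b).
Proof.
intros Hab Hba; apply (le_mp Hab), (le_mp Hba), derives_weaken.
exact (d_axiom _ _ (A11 b a c)).
Qed.

Lemma or_congr a b c d : a ≈ c -> b ≈ d -> a ∨ b ≈ c ∨ d.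
Proof.
intros [? ?] [? ?]; split; apply or_le; eauto using le_trans, le_or_l, le_or_r.
Qed.

Lemma and_congr a b c d : a ≈ c -> b ≈ d -> a ∧ b ≈ c ∧ d.
Proof.
intros H K.
exact (interderivable_trans (and_congr_l b H) (and_congr_r c K)).
Qed.

Lemma neg_congr a b : a ≈ b -> ∼ a ≈ ∼ b.
Proof. intros [? ?]; split; apply neg_le; assumption. Qed.

Lemma imp_congr a b c d : a ≈ c -> b ≈ d -> (a → b) ≈ (c → d).
Proof.
intros H K; apply (@interderivable_trans _ (c → b)%fml).
- destruct H as [Hac Hca].
  split; apply (le_mp (le_refl _)), le_imp_congr_l; auto using derives_weaken.
- destruct K as [Hbd Hdb].
  split; apply (le_mp (le_refl _)), le_imp_congr_r; auto using derives_weaken.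
Qed.

Lemma interderivable_top a : a ≈ ⊤ <-> ⊢ a.
Proof.
split.
- intros [_ H]; exact (d_SMP (d_axiom _ _ A6) H).
- intros H; split; [apply le_top | exact (derives_weaken _ H)].
Qed.

(** [⊤ → a] is interderivable with [⊤ ⇒ a], hence with [a]. *)
Lemma top_imp a : (⊤ → a) ≈ a.
Proof.
apply (@interderivable_trans _ (⊤ ⇒ a)%fml).
- apply imp_congr; [apply interderivable_refl |].
  split; [apply le_and; [apply le_top | apply le_refl] | apply le_and_r].
- split; [| apply le_curry, le_and_l].
  exact (le_mp (le_top _) (le_refl _)).
Qed.

(** Below [a], the formulas [a] and [⊤] are interchangeable as antecedents. *)
Lemma and_imp a b : a ∧ (a → b) ≈ a ∧ b.
Proof.
assert (Htop : a ≼ a ⇒ ⊤) by apply le_curry, le_top.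
assert (Ha : a ≼ ⊤ ⇒ a) by apply le_curry, le_and_l.
destruct (top_imp b) as [Hb Hb'].
split; (apply le_and; [apply le_and_l |]).
- refine (le_trans _ Hb).
  apply le_uncurry, le_imp_congr_l; assumption.
- apply (@le_trans _ (a ∧ (⊤ → b))%fml).
  + apply le_and; [apply le_and_l | apply le_and_weaken_r, Hb'].
  + apply le_uncurry, le_imp_congr_l; assumption.
Qed.

Lemma and_imp_relativize a b c : a ∧ (b → c) ≈ a ∧ ((a ∧ b) → (a ∧ c)).
Proof.
assert (Hrel : forall d, a ≼ d ⇒ (a ∧ d)).
{ intros d; apply le_curry, le_refl. }
assert (Hrel' : forall d, a ≼ (a ∧ d) ⇒ d).
{ intros d; apply le_curry, le_and_weaken_r, le_and_r. }
split; (apply le_and; [apply le_and_l |]).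
- apply (@le_mp _ ((a ∧ b) → c)%fml).
  + apply le_uncurry, le_imp_congr_l; auto.
  + apply (le_trans (le_and_l _ _)), le_imp_congr_r; auto.
- apply (@le_mp _ ((a ∧ b) → c)%fml).
  + apply le_uncurry, le_imp_congr_r; auto.
  + apply (le_trans (le_and_l _ _)), le_imp_congr_l; auto.
Qed.

Lemma imp_refl a : (a → a) ≈ ⊤.
Proof.
apply (@interderivable_trans _ (a ⇒ a)%fml).
- apply imp_congr; [apply interderivable_refl |].
  split; [apply le_and; apply le_refl | apply le_and_l].
- apply interderivable_top, le_refl.
Qed.

Lemma le_imp_bot a b : a ∧ b ≼ ⊥ -> a ≼ b → ⊥.
Proof.
intros H.
assert (K : (b ⇒ ⊥) ≈ (b → ⊥)).
{ apply imp_congr; [apply interderivable_refl |].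
  split; [apply le_and_r | apply bot_le]. }
exact (le_trans (le_curry H) (proj1 K)).
Qed.

Lemma and_imp_bot a : a ∧ (a → ⊥) ≼ ⊥.
Proof. exact (le_trans (proj1 (and_imp a ⊥%fml)) (le_and_r _ _)). Qed.

End Provability.

Local Notation "x ≈[ S , Γ ] y" := (interderivable S Γ x%fml y%fml)
  (at level 70, no associativity).

Lemma derives_mono S Γ Δ a :
  Included _ Γ Δ -> derives S Γ a -> derives S Δ a.
Proof.
intros HΓΔ H; induction H as [a H | s a H | a H | a b _ IHa _ IHb | a b _ IH].
- exact (d_axiom _ _ H).
- exact (d_scheme _ _ H).
- exact (d_hyp _ (HΓΔ a H)).
- exact (d_SMP IHa IHb).
- exact (d_SCP IH).
Qed.

Lemma subst_comp s t a : subst s (subst t a) = subst (fun n => subst s (t n)) a.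
Proof. induction a; simpl; congruence. Qed.

Lemma theorem_subst S s a : is_theorem S a -> is_theorem S (subst s a).
Proof.
intros H; induction H as [a H | t a H | a H | a b _ IHa _ IHb | a b _ IH].
- apply d_axiom; destruct H; constructor.
- rewrite subst_comp; exact (d_scheme _ _ H).
- destruct H.
- exact (d_SMP IHa IHb).
- exact (d_SCP IH).
Qed.

(** * The defining identities of DHMSH *)

(** The identities defining the variety, as schemes: each is closed under
    substitution. *)
Inductive DHMSH_identity : formula -> formula -> Prop :=
| id_joinC a b : DHMSH_identity (a ∨ b) (b ∨ a)
| id_meetC a b : DHMSH_identity (a ∧ b) (b ∧ a)
| id_joinA a b c : DHMSH_identity (a ∨ (b ∨ c)) ((a ∨ b) ∨ c)
| id_meetA a b c : DHMSH_identity (a ∧ (b ∧ c)) ((a ∧ b) ∧ c)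
| id_joinK a b : DHMSH_identity (a ∨ (a ∧ b)) a
| id_meetK a b : DHMSH_identity (a ∧ (a ∨ b)) a
| id_meet_zero a : DHMSH_identity (a ∧ ⊥) ⊥
| id_join_one a : DHMSH_identity (a ∨ ⊤) ⊤
| id_meet_imp a b : DHMSH_identity (a ∧ (a → b)) (a ∧ b)
| id_meet_imp2 a b c :
    DHMSH_identity (a ∧ (b → c)) (a ∧ ((a ∧ b) → (a ∧ c)))
| id_imp_refl a : DHMSH_identity (a → a) ⊤
| id_neg_zero : DHMSH_identity (∼ ⊥) ⊤
| id_neg_one : DHMSH_identity (∼ ⊤) ⊥
| id_neg_meet a b : DHMSH_identity (∼ (a ∧ b)) (∼ a ∨ ∼ b).

Lemma DHMSH_identity_subst s a b :
  DHMSH_identity a b -> DHMSH_identity (subst s a) (subst s b).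
Proof. intros H; destruct H; constructor. Qed.

Lemma DHMSH_algebra_identities A :
  DHMSH_algebra A <-> forall a b, DHMSH_identity a b -> satisfies A a b.
Proof.
split.
- intros [[[]]] a b H v; destruct H; simpl; auto.
- intros H.
  assert (H3 : forall (x y z : A) a b, DHMSH_identity a b ->
    let v n := match n with 0 => x | 1 => y | _ => z end in
    eval v a = eval v b) by (intros x y z a b Hab; exact (H a b Hab _)).
  split; [split; [split |..] |..]; try (intros x y z); try (intros x y);
    try (intros x).
  + exact (H3 x y x _ _ (id_joinC (Var 0) (Var 1))).
  + exact (H3 x y x _ _ (id_meetC (Var 0) (Var 1))).
  + exact (H3 x y z _ _ (id_joinA (Var 0) (Var 1) (Var 2))).
  + exact (H3 x y z _ _ (id_meetA (Var 0) (Var 1) (Var 2))).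
  + exact (H3 x y x _ _ (id_joinK (Var 0) (Var 1))).
  + exact (H3 x y x _ _ (id_meetK (Var 0) (Var 1))).
  + exact (H3 x x x _ _ (id_meet_zero (Var 0))).
  + exact (H3 x x x _ _ (id_join_one (Var 0))).
  + exact (H3 x y x _ _ (id_meet_imp (Var 0) (Var 1))).
  + exact (H3 x y z _ _ (id_meet_imp2 (Var 0) (Var 1) (Var 2))).
  + exact (H3 x x x _ _ (id_imp_refl (Var 0))).
  + exact (H (∼ ⊥)%fml ⊤%fml id_neg_zero (fun _ => zero)).
  + exact (H (∼ ⊤)%fml ⊥%fml id_neg_one (fun _ => zero)).
  + exact (H3 x y x _ _ (id_neg_meet (Var 0) (Var 1))).
Qed.

(** The variety of an extension is an equational class: its identities are those
    of DHMSH together with [a ≈ 1] for every theorem [a]. *)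
Lemma corresponding_variety_identities S A :
  corresponding_variety S A <->
  forall a b, DHMSH_identity a b \/ is_theorem S a /\ b = ⊤%fml ->
    satisfies A a b.
Proof.
unfold corresponding_variety; rewrite DHMSH_algebra_identities.
split.
- intros [Hid Hthm] a b [H | [H ->]]; auto.
- intros H; split; auto.
Qed.

Lemma identity_interderivable S Γ a b : DHMSH_identity a b -> a ≈[S, Γ] b.
Proof.
intros H; destruct H.
- split; apply or_le; auto using le_or_l, le_or_r.
- apply and_comm.
- split; repeat apply or_le; eauto using le_trans, le_or_l, le_or_r.
- split; repeat apply le_and; eauto using le_trans, le_and_l, le_and_r.
- split; [apply or_le; auto using le_refl, le_and_l | apply le_or_l].
- split; [apply le_and_l | apply le_and; auto using le_refl, le_or_l].
- split; [apply le_and_r | apply bot_le].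
- split; [apply le_top | apply le_or_r].
- apply and_imp.
- apply and_imp_relativize.
- apply imp_refl.
- split; [apply le_top | exact (d_axiom _ _ A12)].
- split; [exact (d_axiom _ _ A13) | apply bot_le].
- split; [exact (d_axiom _ _ (A14 a b)) |].
  apply or_le; apply neg_le; auto using le_and_l, le_and_r.
Qed.

(** * The Lindenbaum algebra of a theory *)

Section Lindenbaum.

Context (S Γ : Ensemble formula).

(** The quotient of the set of formulas by interderivability; a class is the
    predicate of its members. *)
Definition lindenbaum_car : Type :=
  {P : formula -> Prop | exists a, P = interderivable S Γ a}.

Definition cls (a : formula) : lindenbaum_car :=
  exist _ (interderivable S Γ a) (ex_intro _ a eq_refl).

Definition rep (X : lindenbaum_car) : formula :=
  proj1_sig (constructive_indefinite_description _ (proj2_sig X)).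

Lemma rep_cls X : cls (rep X) = X.
Proof.
unfold rep; destruct constructive_indefinite_description as [a Ha]; simpl.
destruct X as [P HP]; apply subset_eq_compat; simpl in Ha; congruence.
Qed.

Lemma cls_eq a b : cls a = cls b <-> a ≈[S, Γ] b.
Proof.
split.
- intros H; injection H as H.
  rewrite H; apply interderivable_refl.
- intros H; apply subset_eq_compat.
  apply functional_extensionality; intros c; apply propositional_extensionality.
  split; apply interderivable_trans; auto using interderivable_sym.
Qed.

Lemma cls_rep a : rep (cls a) ≈[S, Γ] a.
Proof. apply cls_eq, rep_cls. Qed.

(** The operations act on chosen representatives; the choice is immaterial as
    interderivability is a congruence. *)
Definition lindenbaum : dh_algebra :=
  @DHAlgebra
    (@SHAlgebra lindenbaum_car
      (fun X Y => cls (rep X ∨ rep Y))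
      (fun X Y => cls (rep X ∧ rep Y))
      (fun X Y => cls (rep X → rep Y))
      (cls ⊥) (cls ⊤))
    (fun X => cls (∼ rep X)).

Lemma eval_lindenbaum (v : nat -> lindenbaum) a :
  eval v a = cls (subst (fun n => rep (v n)) a).
Proof.
induction a as [n | a IHa b IHb | a IHa b IHb | a IHa b IHb | a IHa | |]; simpl.
- symmetry; apply rep_cls.
- rewrite IHa, IHb; apply cls_eq, or_congr; apply cls_rep.
- rewrite IHa, IHb; apply cls_eq, and_congr; apply cls_rep.
- rewrite IHa, IHb; apply cls_eq, imp_congr; apply cls_rep.
- rewrite IHa; apply cls_eq, neg_congr, cls_rep.
- reflexivity.
- reflexivity.
Qed.

Lemma lindenbaum_corresponding_variety : corresponding_variety S lindenbaum.
Proof.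
apply corresponding_variety_identities; intros a b H v.
rewrite !eval_lindenbaum; apply cls_eq.
destruct H as [H | [H ->]].
- apply identity_interderivable, DHMSH_identity_subst, H.
- apply interderivable_top.
  apply (@derives_mono _ (Empty_set formula)); [intros c [] |].
  apply theorem_subst, H.
Qed.

End Lindenbaum.

(** Algebraic completeness: an identity valid in the variety is an equivalence
    of every theory, as seen on the Lindenbaum algebra at the valuation sending
    each variable to its own class. *)
Lemma variety_interderivable S Γ a b :
  (forall A, corresponding_variety S A -> satisfies A a b) -> a ≈[S, Γ] b.
Proof.
intros H.
pose proof (H _ (lindenbaum_corresponding_variety S Γ)
  (fun n => cls S Γ (Var n))) as E.
rewrite !eval_lindenbaum in E; apply cls_eq in E.
assert (Hsub : forall c, subst (fun n => rep (cls S Γ (Var n))) c ≈[S, Γ] c).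
{ intros c; induction c; simpl.
  - apply cls_rep.
  - apply or_congr; assumption.
  - apply and_congr; assumption.
  - apply imp_congr; assumption.
  - apply neg_congr; assumption.
  - apply interderivable_refl.
  - apply interderivable_refl. }
apply (interderivable_trans (interderivable_sym (Hsub a))).
exact (interderivable_trans E (Hsub b)).
Qed.

(** * Deduction Property from pseudocomplemented negation *)

(** If [∼ a] and [a → ⊥] are interderivable, the contraposition rule holds in
    the presence of a side hypothesis [c], and so the deduction theorem goes
    through by induction on the derivation. *)
Lemma deduction_property_of_neg S :
  (forall Γ a, ∼ a ≈[S, Γ] (a → ⊥)) -> deduction_property (derives S) ImpH.
Proof.
intros Hneg Γ c d; split.
- intros H; induction H as [a H | s a H | a H | a b _ IHa _ IHb | a b _ IH].
  + exact (derives_weaken c (d_axiom _ _ H)).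
  + exact (derives_weaken c (d_scheme _ _ H)).
  + destruct H as [a H | a H].
    * exact (derives_weaken c (d_hyp _ H)).
    * destruct H; apply le_refl.
  + exact (le_mp IHa IHb).
  + (* [c ∧ ∼b ∧ a] entails both [b] and [b → ⊥]. *)
    apply le_curry; refine (le_trans _ (proj2 (Hneg Γ a))); apply le_imp_bot.
    refine (le_trans _ (and_imp_bot S Γ b)).
    pose proof (le_and_l S Γ (c ∧ ∼ b) a) as H1.
    pose proof (le_and_r S Γ (c ∧ ∼ b) a) as Ha.
    apply le_and.
    * apply (le_mp Ha), (le_trans H1), (le_trans (le_and_l S Γ _ _)), IH.
    * refine (le_trans H1 (le_trans (le_and_r S Γ _ _) (proj1 (Hneg Γ b)))).
- intros H; apply (@d_SMP _ _ c).
  + apply d_hyp; right; constructor.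
  + apply (@derives_mono _ Γ); [intros a Ha; left; exact Ha | exact H].
Qed.

Lemma expansion_class_neg V A :
  expansion_class V A -> forall x : A, neg x = star x.
Proof. intros [L [_ ->]] x; reflexivity. Qed.

(** * Pseudocomplemented negation from the Deduction Property *)

Section SemiHeyting.

Context (L : sh_algebra) (HL : semi_heyting L).
Local Open Scope alg_scope.

Lemma meet_one_r (x : L) : x ∧ ⊤ = x.
Proof.
rewrite <- (join_one (sh_lattice HL) x); apply (meetK (sh_lattice HL)).
Qed.

Lemma meet_one_l (x : L) : ⊤ ∧ x = x.
Proof. rewrite (meetC (sh_lattice HL)); apply meet_one_r. Qed.

Lemma meet_zero_l (x : L) : ⊥ ∧ x = ⊥.
Proof. rewrite (meetC (sh_lattice HL)); apply (meet_zero (sh_lattice HL)). Qed.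

Lemma one_imp (x : L) : ⊤ → x = x.
Proof.
rewrite <- (meet_one_l (⊤ → x)), (sh_meet_imp HL); apply meet_one_l.
Qed.

(** One half of the residuation law for the Heyting implication
    [x ⇒ y := x → (x ∧ y)], at the unit. *)
Lemma impH_one_le (x y : L) : x → (x ∧ y) = ⊤ -> x ∧ y = x.
Proof.
intros H; rewrite <- (meet_one_r x) at 2; rewrite <- H, (sh_meet_imp HL).
rewrite (meetA (sh_lattice HL)); f_equal.
rewrite <- (joinK (sh_lattice HL) x x) at 3; symmetry.
apply (meetK (sh_lattice HL)).
Qed.

Lemma meet_eq_zero_star (x y : L) : y ∧ x = ⊥ -> y ∧ star x = y.
Proof.
intros H; unfold star.
rewrite (sh_meet_imp2 HL), H, (meet_zero (sh_lattice HL)), (sh_imp_refl HL).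
apply meet_one_r.
Qed.

End SemiHeyting.

(** Contraposition from [x] to [0] gives [x* ≤ x'], and contraposition from [1]
    to [x] gives [x ≤ x'*], that is [x ∧ x' = 0], so [x' ≤ x*]. *)
Lemma neg_star_of_contraposition A :
  DHMSH_algebra A ->
  satisfies A ((Var 0 ⇒ Var 1) ⇒ (∼ Var 1 ⇒ ∼ Var 0)) ⊤ ->
  forall x : A, neg x = star x.
Proof.
intros [HA Hn0 Hn1 _] Hcontra x; pose proof (sh_lattice HA) as HL.
assert (contra : forall a b : A,
  meet (imp a (meet a b)) (imp (neg b) (meet (neg b) (neg a))) =
  imp a (meet a b)).
{ intros a b; apply (impH_one_le HA).
  exact (Hcontra (fun n => match n with 0 => a | _ => b end)). }
assert (H1 : meet (star x) (neg x) = star x).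
{ generalize (contra x zero).
  rewrite Hn0, (meet_one_l HA), (one_imp HA), (meet_zero HL); trivial. }
assert (H2 : meet (neg x) x = zero).
{ generalize (contra one x).
  rewrite Hn1, (meet_one_l HA), (one_imp HA), (meet_zero HL).
  intros E; rewrite <- E at 2.
  rewrite (meetC HL x), (meetA HL), (sh_meet_imp HA).
  rewrite (meet_zero HL); apply (meet_zero_l HA). }
rewrite <- (meet_eq_zero_star HA H2), (meetC HL); exact H1.
Qed.

Lemma stone_of_neg_star A :
  DHMSH_algebra A -> (forall x : A, neg x = star x) -> stone_semi_heyting A.
Proof.
intros [HA Hn0 _ Hnm] Hstar; pose proof (sh_lattice HA) as HL.
split; [exact HA |]; intros x.
rewrite <- !Hstar, <- Hnm, (Hstar x); unfold star.
rewrite (sh_meet_imp HA), (meet_zero HL); exact Hn0.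
Qed.

(** An equality of structures, by extensionality of the operation [∼]. *)
Lemma expansion_of_neg_star (A : dh_algebra) :
  (forall x : A, neg x = star x) -> A = expansion A.
Proof.
destruct A as [L n]; intros H; unfold expansion; f_equal.
apply functional_extensionality, H.
Qed.

(** * Expansions of varieties *)

Lemma eval_hom (L M : sh_algebra) (f : L -> M) (v : nat -> L) a :
  sh_hom f ->
  f (eval (A := expansion L) v a) =
  eval (A := expansion M) (fun n => f (v n)) a.
Proof.
intros [Hj Hm Hi H0 H1].
induction a as [n | a IHa b IHb | a IHa b IHb | a IHa b IHb | a IHa | |]; simpl.
- reflexivity.
- rewrite Hj, IHa, IHb; reflexivity.
- rewrite Hm, IHa, IHb; reflexivity.
- rewrite Hi, IHa, IHb; reflexivity.
- unfold star; rewrite Hi, IHa, H0; reflexivity.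
- exact H0.
- exact H1.
Qed.

Lemma proj_hom (I : Type) (L : I -> sh_algebra) i :
  sh_hom (fun x : sh_prod L => x i).
Proof. split; reflexivity. Qed.

(** The easy half of Birkhoff's theorem, for identities in the language with
    [∼] read as the pseudocomplement. *)
Lemma variety_of_identities (E : formula -> formula -> Prop) :
  variety (fun L => forall a b, E a b -> satisfies (expansion L) a b).
Proof.
split.
- intros L M f Hf Hsurj HL a b Hab v.
  destruct (functional_choice _ (fun n => Hsurj (v n))) as [w Hw].
  replace v with (fun n => f (w n)) by
    (apply functional_extensionality; exact Hw).
  rewrite <- !(eval_hom w _ Hf); f_equal; exact (HL a b Hab w).
- intros L M f Hf Hinj HM a b Hab v.
  apply Hinj; rewrite !(eval_hom v _ Hf); exact (HM a b Hab _).
- intros I L HL a b Hab v; apply functional_extensionality_dep; intros i.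
  pose proof (eval_hom v a (proj_hom L i)) as Ha.
  pose proof (eval_hom v b (proj_hom L i)) as Hb; simpl in Ha, Hb.
  rewrite Ha, Hb; exact (HL i a b Hab _).
Qed.

Theorem theorem6p7 : forall S : Ensemble formula,
  deduction_property (derives S) ImpH <->
  exists V : sh_algebra -> Prop,
    subvariety V stone_semi_heyting /\
    forall A : dh_algebra,
      corresponding_variety S A <-> expansion_class V A.
Proof.
intros S; split.
- intros HDP.
  assert (Hcontra : is_theorem S
    ((Var 0 ⇒ Var 1) ⇒ (∼ Var 1 ⇒ ∼ Var 0))%fml).
  { apply HDP, d_SCP, d_hyp; right; constructor. }
  assert (Hneg : forall A, corresponding_variety S A ->
    forall x : A, neg x = star x).
  { intros A [HA Hthm]; apply neg_star_of_contraposition; auto. }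
  (* [V] is the class of the [L] with [L^e] in the variety of the logic,
     presented by its identities. *)
  exists (fun L => forall a b,
    DHMSH_identity a b \/ is_theorem S a /\ b = ⊤%fml ->
    satisfies (expansion L) a b).
  split; [split |].
  + apply variety_of_identities.
  + intros L HL.
    apply corresponding_variety_identities in HL.
    exact (stone_of_neg_star (proj1 HL) (Hneg _ HL)).
  + intros A; split.
    * intros HA; pose proof (expansion_of_neg_star (Hneg A HA)) as HE.
      exists A; split; [| exact HE].
      apply corresponding_variety_identities; rewrite <- HE; exact HA.
    * intros [L [HL ->]]; apply corresponding_variety_identities, HL.
- intros [V [_ HV]]; apply deduction_property_of_neg; intros Γ a.
  apply variety_interderivable; intros A HA v.
  apply HV in HA; exact (expansion_class_neg HA _).
Qed.
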